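(* There is a constant $c>0$ such that for every $n\ge1$, with $N=2^n$, there is a quantum circuit on $n+1$ qubits (one of them an ancilla qubit; plus possibly a constant number of further scratch qubits starting and ending in $|0\rangle$) consisting of at most $c\,n^2$ elementary gates which maps $|0\rangle\otimes v\mapsto|0\rangle\otimes A_N v$ for every $v\in\mathbb{C}^N$. That is, the discrete Hartley transform $A_N$ can be computed with $O(\log^2N)$ elementary operations using one additional ancilla qubit.
   Context: Qubit/basis conventions: the state space of $m$ qubits is $\mathbb{C}^{2^m}$ with computational basis $|x\rangle$ for bit strings $x$ read as binary integers. Elementary gates: (i) a CNOT between any two qubits, and (ii) any single-qubit gate $I_{2^{m-t}}\otimes U\otimes I_{2^{t-1}}$ with $U\in\mathcal U(2)$ arbitrary. The discrete Hartley transform is $A_N=\frac1{\sqrt N}[\mathrm{cas}(2\pi jk/N)]_{j,k=0,\dots,N-1}$ with $\mathrm{cas}(t)=\cos t+\sin t$. *)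

(* Defs.v *)
(* with MathComp-Analysis (cos, sin, pi on a realType R)
   and real_closed's complex numbers R[i]. *)
From HB Require Import structures.
From mathcomp Require Import all_boot all_order all_algebra.
From mathcomp Require Import reals trigo.
From mathcomp Require Import complex.
Set Implicit Arguments. Unset Strict Implicit. Unset Printing Implicit Defensive.
Import Order.TTheory GRing.Theory Num.Theory.
Local Open Scope ring_scope.
Local Open Scope complex_scope.

(* Basis convention: |x>, x read as a binary integer; qubit number t (0-based
   here) is bit t of x, i.e. the paper's qubit t+1, acted on by
   I_{2^{m-t-1}} (x) U (x) I_{2^t}. *)
Definition bit (t x : nat) : bool := odd (x %/ 2 ^ t).

(* CNOT with control qubit i and target qubit j: |x> |-> |x xor (bit_i x) 2^j> *)
Definition cnot_map (i j x : nat) : nat :=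
  if bit i x then (if bit j x then x - 2 ^ j else x + 2 ^ j)%N else x.

Definition cnot_mx (R : rcfType) (m : nat) (a b : 'I_m) : 'M[R[i]]_(2 ^ m) :=
  \matrix_(y, x) (if (y : nat) == cnot_map a b x then 1 else 0).

(* I_{2^{m-t-1}} (x) U (x) I_{2^t}, written out entrywise. *)
Definition single_mx (R : rcfType) (m : nat) (t : 'I_m) (U : 'M[R[i]]_2)
  : 'M[R[i]]_(2 ^ m) :=
  \matrix_(y, x)
    (if ((y %/ 2 ^ t.+1)%N == (x %/ 2 ^ t.+1)%N) && ((y %% 2 ^ t)%N == (x %% 2 ^ t)%N)
     then U (inord (bit t y)) (inord (bit t x)) else 0).

Definition unitary2 (R : rcfType) (U : 'M[R[i]]_2) : Prop :=
  U *m (map_mx (fun z => z^*) U)^T = 1%:M.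

(* Elementary gates on m qubits. *)
Definition elementary_gate (R : rcfType) (m : nat) (G : 'M[R[i]]_(2 ^ m)) : Prop :=
  (exists (a b : 'I_m), a != b /\ G = @cnot_mx R m a b) \/
  (exists (t : 'I_m) (U : 'M[R[i]]_2), unitary2 U /\ G = @single_mx R m t U).

(* The matrix implemented by a circuit given as a list of gates
   [G_L; ...; G_1] : the product G_L * ... * G_1 (head applied last). *)
Definition circuit_mx (R : rcfType) (m : nat) (gs : seq 'M[R[i]]_(2 ^ m))
  : 'M[R[i]]_(2 ^ m) := foldr (@mulmx _ _ _ _) 1%:M gs.

(* |0...0> (x) v : embeds v in C^{2^n} into C^{2^m} (all qubits of index
   >= n, i.e. ancilla and scratch, set to 0). *)
Definition embed (R : rcfType) (n m : nat) (v : 'cV[R[i]]_(2 ^ n)) : 'cV[R[i]]_(2 ^ m) :=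
  \col_(x < 2 ^ m) (if @insub nat (fun k => k < 2 ^ n)%N 'I_(2 ^ n) x is Some k
                    then v k 0 else 0).

Definition cas (R : realType) (t : R) : R := cos t + sin t.

(* Discrete Hartley transform A_N, N = 2^n, as a complex matrix. *)
Definition hartley (R : realType) (n : nat) : 'M[R[i]]_(2 ^ n) :=
  \matrix_(j, k)
    ((Num.sqrt ((2 ^ n)%:R : R))^-1
       * cas (2 * pi * ((j : nat) * (k : nat))%:R / (2 ^ n)%:R))%:C.

(* Main.v *)
Require Import Defs.
From HB Require Import structures.
From mathcomp Require Import all_boot all_order all_algebra.
From mathcomp Require Import reals trigo.
From mathcomp Require Import complex.
From mathcomp Require Import boolp ring zify.
Set Implicit Arguments. Unset Strict Implicit. Unset Printing Implicit Defensive.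
Import Order.TTheory GRing.Theory Num.Theory.
Local Open Scope ring_scope.

(** Let [F] be the Fourier matrix with entries [e^{2 pi i j k / N} / sqrt N] and
    [F'] its conjugate, so that [F F' = 1], [F^3 = F'] and
    [A_N = ((1 - i) F + (1 + i) F') / 2].  Let [W] apply [F] or [F'] to the data
    qubits according to the ancilla.  Preparing the ancilla in
    [((1 + i) |0> + (1 - i) |1>) / 2], applying [W] and then a Hadamard gate to
    the ancilla gives
    [(|0> ((1 + i) F + (1 - i) F') v + |1> ((1 + i) F - (1 - i) F') v) / sqrt 8].
    Applying [F] and then [W] multiplies the first component by [F^2], which
    exchanges [F] and [F'], and leaves the second one alone; the result is
    [(|0> + i |1>) A_N v / sqrt 2], and a last gate returns the ancilla to [|0>].
    [F] and [W] are the textbook Fourier circuit; in [W] the sign of each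
    controlled phase depends on the ancilla. *)

(** * Binary digits *)

Section Bits.
Local Open Scope nat_scope.
Implicit Types h i j l m n t x y : nat.

Lemma expn2_gt0 n : 0 < 2 ^ n. Proof. by rewrite expn_gt0. Qed.

Lemma divn_cat n h l : l < 2 ^ n -> (h * 2 ^ n + l) %/ 2 ^ n = h.
Proof. by move=> hl; rewrite divnMDl ?expn2_gt0 // divn_small ?addn0. Qed.

Lemma modn_cat n h l : l < 2 ^ n -> (h * 2 ^ n + l) %% 2 ^ n = l.
Proof. by move=> hl; rewrite modnMDl modn_small. Qed.

Lemma bit_div n t x : bit t (x %/ 2 ^ n) = bit (n + t) x.
Proof. by rewrite /bit expnD divnMA. Qed.

Lemma bit_cat n t h l : l < 2 ^ n ->
  bit t (h * 2 ^ n + l) = if t < n then bit t l else bit (t - n) h.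
Proof.
move=> hl; case: ltnP => htn; last first.
  by rewrite -[X in bit (_ - _) X](divn_cat h hl) bit_div subnKC.
(* After division by [2 ^ t] the high part is a multiple of [2 ^ (n - t)], which is even, so it does
   not affect the parity. *)
rewrite /bit -(subnK (ltnW htn)) expnD mulnA divnMDl ?expn2_gt0 // oddD oddM.
by rewrite oddX subn_eq0 leqNgt htn /= andbF.
Qed.

Lemma bit_small t x : x < 2 ^ t -> bit t x = false.
Proof. by move=> hx; rewrite /bit divn_small. Qed.

Lemma bit_bool t (b : bool) : bit t b = (t == 0) && b.
Proof.
case: t => [|t]; first by rewrite /bit divn1 oddb.
rewrite bit_small //; case: b; rewrite ?expn2_gt0 //.
by rewrite -[true : nat](expn0 2) ltn_exp2l.
Qed.

Lemma bool_lt2 (b : bool) : b < 2 ^ 1. Proof. by case: b. Qed.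

Lemma bit_cons t h (b : bool) :
  bit t (h * 2 + b) = if t is t'.+1 then bit t' h else b.
Proof.
rewrite -[X in _ * X](expn1 2) bit_cat ?bool_lt2 //.
by case: t => [|t]; rewrite ?bit_bool //= subn1.
Qed.

Lemma nat_cons x : x = x %/ 2 * 2 + bit 0 x.
Proof. by rewrite /bit divn1 -modn2 -divn_eq. Qed.

(** Strong induction on the larger number: halving both drops a common lowest bit. The pair of
    zeros, which halving does not decrease, is treated apart. *)
Lemma bit_ext x y : (forall t, bit t x = bit t y) -> x = y.
Proof.
have [N] := ubnP (maxn x y); elim: N x y => // N IHN x y.
rewrite ltnS => hN eq_b.
have [[x0 y0]|hxy] : (x = 0 /\ y = 0) \/ (0 < maxn x y).
- by case: (posnP (maxn x y)) => h; [left; split; lia | right].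
- by rewrite x0 y0.
have eq_h : x %/ 2 = y %/ 2.
  apply: IHN => [|t]; first by lia.
  by rewrite !(bit_div 1) eq_b.
by rewrite (nat_cons x) (nat_cons y) eq_h eq_b.
Qed.

Lemma ltn_exp2P m x : reflect (forall t, m <= t -> bit t x = false) (x < 2 ^ m).
Proof.
apply: (iffP idP) => [hx t hmt|hb].
  by rewrite bit_small //; apply: (leq_trans hx); rewrite leq_exp2l.
rewrite -(mul1n (2 ^ m)) -ltn_divLR ?expn2_gt0 // ltnS leqn0; apply/eqP.
apply: bit_ext => t; rewrite bit_div hb ?leq_addr //.
by rewrite bit_small ?expn2_gt0.
Qed.

Lemma nat_bit t x : x = (x %/ 2 ^ t.+1 * 2 + bit t x) * 2 ^ t + x %% 2 ^ t.
Proof.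
rewrite {1}(divn_eq x (2 ^ t)); congr (_ * _ + _).
by rewrite {1}(nat_cons (x %/ 2 ^ t)) bit_div addn0 -divnMA -expnSr.
Qed.

(** * Setting one bit, and the bit permutations computed by CNOTs *)

Definition setbit t (b : bool) x :=
  (x %/ 2 ^ t.+1 * 2 + b) * 2 ^ t + x %% 2 ^ t.

Lemma bit_setbit s t b x : bit s (setbit t b x) = if s == t then b else bit s x.
Proof.
have hl : x %% 2 ^ t < 2 ^ t by rewrite ltn_pmod ?expn2_gt0.
rewrite {2}(nat_bit t x) /setbit !bit_cat // !bit_cons.
case: (ltngtP s t) => // [hst|->]; last by rewrite subnn.
by rewrite -(prednK (n := s - t)) ?subn_gt0.
Qed.

Lemma setbit_id t x : setbit t (bit t x) x = x.
Proof. by rewrite /setbit -nat_bit. Qed.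

Lemma setbit_lt m t b x : t < m -> x < 2 ^ m -> setbit t b x < 2 ^ m.
Proof.
move=> htm /ltn_exp2P hx; apply/ltn_exp2P => s hs.
by rewrite bit_setbit hx //; case: eqP => // eq_st; lia.
Qed.

(** The left-hand side is the support condition in [single_mx]; row [y] of such a gate thus has at
    most two nonzero entries, in the columns [setbit t false y] and [setbit t true y]. *)
Lemma setbitP t x y :
  ((y %/ 2 ^ t.+1 == x %/ 2 ^ t.+1) && (y %% 2 ^ t == x %% 2 ^ t)) =
  (x == setbit t (bit t x) y).
Proof.
apply/andP/eqP => [[/eqP e1 /eqP e2]|ex].
  by rewrite /setbit e1 e2 -nat_bit.
have hl : y %% 2 ^ t < 2 ^ t by rewrite ltn_pmod ?expn2_gt0.
split; apply/eqP; rewrite ex; last by rewrite modn_cat.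
rewrite /setbit !expnSr !divnMA divn_cat // divnMDl //.
by rewrite (divn_small (bool_lt2 _)) addn0.
Qed.

(** Adding or subtracting [2 ^ j] never carries here, because the choice depends on bit [j]
    itself. *)
Lemma cnot_mapE i j x : cnot_map i j x = setbit j (bit j x (+) bit i x) x.
Proof.
rewrite /cnot_map; case: (bit i x); last by rewrite addbF setbit_id.
have := nat_bit j x; rewrite /setbit.
by move: (2 ^ j) (bit j x) (x %/ _) (x %% _) => d [] q r /=; lia.
Qed.

Lemma bit_cnot t i j x :
  bit t (cnot_map i j x) = bit t x (+) ((t == j) && bit i x).
Proof.
by rewrite cnot_mapE bit_setbit; case: eqP => [->|_] //=; rewrite addbF.
Qed.

Lemma cnot_map_lt m i j x : j < m -> x < 2 ^ m -> cnot_map i j x < 2 ^ m.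
Proof. by move=> hj hx; rewrite cnot_mapE setbit_lt. Qed.

Lemma cnot_mapK i j : i != j -> involutive (cnot_map i j).
Proof.
move=> nij x; apply: bit_ext => t; rewrite !bit_cnot (negPf nij) /= addbF.
by rewrite -addbA addbb addbF.
Qed.

Definition swap_map i j x := cnot_map i j (cnot_map j i (cnot_map i j x)).

Lemma bit_swap t i j x : i != j -> bit t (swap_map i j x) =
  bit (if t == i then j else if t == j then i else t) x.
Proof.
move=> nij; have nji : j != i by rewrite eq_sym.
rewrite /swap_map; case: (eqVneq t i) => [->|nti].
  rewrite !bit_cnot !eqxx ?(negPf nij) ?(negPf nji) /= ?addbF.
  by case: (bit i x); case: (bit j x).
case: (eqVneq t j) => [->|ntj].
  rewrite !bit_cnot !eqxx ?(negPf nij) ?(negPf nji) /= ?addbF.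
  by case: (bit i x); case: (bit j x).
by rewrite !bit_cnot (negPf nti) (negPf ntj) /= !addbF.
Qed.

(** A cyclic shift of the low [n + 1] bits that moves bit 0 to position [n], built from swaps of
    neighbours. One such shift at each level of the Fourier recursion replaces the usual final bit
    reversal. *)
Fixpoint rotate n x := if n is n'.+1 then swap_map n' n (rotate n' x) else x.

Lemma bit_rotate n t x : bit t (rotate n x) =
  bit (if t < n then t.+1 else if t == n then 0 else t) x.
Proof.
elim: n t => [|n IHn] t /=; first by case: t.
rewrite bit_swap ?neq_ltn ?ltnSn // IHn; congr (bit _ x).
case: (ltngtP t n) => [htn|hnt|->].
- by rewrite (ltn_eqF (ltnW htn : t < n.+1)) htn ltnS (ltnW htn).
- case: (eqVneq t n.+1) => [->|ne]; first by rewrite !ltnn eqxx.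
  by rewrite (ltnNge t n) (ltnW hnt) /= (gtn_eqF hnt) ltnS leqNgt hnt.
- by rewrite ltnNge leqnSn /= (gtn_eqF (ltnSn n)) ltnSn.
Qed.

Lemma rotateE n h j (b : bool) : j < 2 ^ n ->
  rotate n (h * 2 ^ n.+1 + (j * 2 + b)) = (h * 2 + b) * 2 ^ n + j.
Proof.
move=> hj; have hl : j * 2 + b < 2 ^ n.+1 by rewrite expnSr; case: b; lia.
apply: bit_ext => t; rewrite bit_rotate !bit_cat // !bit_cons.
case: (ltngtP t n) => [htn|hnt|->].
- by rewrite ltnS htn.
- rewrite ltnS leqNgt hnt /= subnS.
  by case: (t - n) (subn_gt0 n t); rewrite ?hnt.
- by rewrite subnn.
Qed.

End Bits.

(** * Circuits acting on amplitude functions *)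

Section Circuits.
Variables (R : realType) (m : nat).
Implicit Types (f g : nat -> R[i]) (T : (nat -> R[i]) -> nat -> R[i]).
Implicit Types (a b c t p : 'I_m) (L : nat).

Local Arguments conjc : simpl never.
Local Arguments real_complex_def : simpl never.

Definition vec f : 'cV[R[i]]_(2 ^ m) := \col_x f x.

(** Operators act on functions over all of [nat], so that bit manipulations need no bound proofs;
    [vec] only sees the values below [2 ^ m]. *)
Definition implements L T := exists gs : seq 'M[R[i]]_(2 ^ m),
  [/\ forall G, G \in gs -> elementary_gate G, (size gs <= L)%N
    & forall f, circuit_mx gs *m vec f = vec (T f)].

Lemma eq_implements L T T' :
  (forall f y, (y < 2 ^ m)%N -> T f y = T' f y) ->
  implements L T -> implements L T'.
Proof.
move=> eqT [gs [gsE gsL gsT]]; exists gs; split=> // f; rewrite gsT.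
by apply/colP => y; rewrite !mxE eqT.
Qed.

Lemma implements_leq L L' T : (L <= L')%N -> implements L T -> implements L' T.
Proof.
by move=> hL [gs [gsE gsL gsT]]; exists gs; split=> //; apply: leq_trans hL.
Qed.

Lemma implements_id : implements 0 (fun f => f).
Proof. by exists [::]; split=> // f; rewrite mul1mx. Qed.

Lemma circuit_mx_cat (gs hs : seq 'M[R[i]]_(2 ^ m)) :
  circuit_mx (gs ++ hs) = circuit_mx gs *m circuit_mx hs.
Proof.
by elim: gs => [|G gs IH] /=; rewrite ?mul1mx // /circuit_mx /= -mulmxA -IH.
Qed.

Lemma implements_comp L1 L2 T1 T2 : implements L1 T1 -> implements L2 T2 ->
  implements (L1 + L2) (fun f => T1 (T2 f)).
Proof.
move=> [gs [gsE gsL gsT]] [hs [hsE hsL hsT]]; exists (gs ++ hs); split=> [G||f].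
- by rewrite mem_cat => /orP[/gsE|/hsE].
- by rewrite size_cat leq_add.
- by rewrite circuit_mx_cat -mulmxA hsT gsT.
Qed.

Lemma implements_gate (G : 'M[R[i]]_(2 ^ m)) T : elementary_gate G ->
  (forall f, G *m vec f = vec (T f)) -> implements 1 T.
Proof.
move=> GE GT; exists [:: G]; split=> // [H|f]; first by rewrite inE => /eqP->.
by rewrite /circuit_mx /= mulmx1.
Qed.

(** A permutation matrix acts on amplitudes through the inverse permutation, and a CNOT is its own
    inverse. *)
Lemma implements_cnot a b : a != b ->
  implements 1 (fun f y => f (cnot_map a b y)).
Proof.
move=> nab; apply: (@implements_gate (cnot_mx R a b)).
  by left; exists a, b.
move=> f; apply/colP => y; rewrite !mxE.
have hy := cnot_map_lt a (ltn_ord b) (ltn_ord y).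
rewrite (bigD1 (Ordinal hy)) //= !mxE /= cnot_mapK // eqxx mul1r big1 ?addr0 //.
move=> x nx; rewrite !mxE; case: eqP => [yE|]; last by rewrite mul0r.
by case/eqP: nx; apply: val_inj; rewrite /= yE cnot_mapK.
Qed.

Definition mx2 (u : bool -> bool -> R[i]) : 'M[R[i]]_2 :=
  \matrix_(i, j) u (odd i) (odd j).

Lemma mx2E u (i j : bool) : mx2 u (inord i) (inord j) = u i j.
Proof. by rewrite mxE !inordK ?oddb //; case: (i); case: (j). Qed.

Definition unitary_fun (u : bool -> bool -> R[i]) :=
  forall i j : bool,
    u i false * (u j false)^*%C + u i true * (u j true)^*%C = (i == j)%:R.

Lemma unitary2_mx2 u : unitary_fun u -> unitary2 (mx2 u).
Proof.
move=> uu; apply/matrixP => i j; rewrite !mxE big_ord_recl big_ord1 !mxE /= uu.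
by case: i => -[|[|//]] ?; case: j => -[|[|//]] ?.
Qed.

Definition app1 (t : nat) (u : bool -> bool -> R[i]) f y : R[i] :=
  u (bit t y) false * f (setbit t false y) +
  u (bit t y) true * f (setbit t true y).

Lemma implements_app1 t u : unitary_fun u -> implements 1 (app1 t u).
Proof.
move=> uu; apply: (@implements_gate (single_mx t (mx2 u))).
  by right; exists t, (mx2 u); split=> //; apply: unitary2_mx2.
move=> f; apply/colP => y; rewrite [LHS]mxE [RHS]mxE.
under eq_bigr => x _ do rewrite [X in X * _]mxE mx2E setbitP [vec f x 0]mxE.
(* The sum defining the matrix product reduces to these two columns. *)
pose o (i : bool) := Ordinal (setbit_lt i (ltn_ord t) (ltn_ord y)).
have no : o true != o false.
  apply/eqP => /(congr1 (fun x : 'I__ => bit t x)) /=.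
  by rewrite !bit_setbit eqxx.
rewrite (bigD1 (o false)) // (bigD1 (o true)) ?no //=.
rewrite !bit_setbit !eqxx addrA big1 ?addr0 // => x /andP[n0 n1].
case: eqP => [xE|]; last by rewrite mul0r.
case: (bit t x) xE => xE; first by case/eqP: n1; apply: val_inj.
by case/eqP: n0; apply: val_inj.
Qed.

(** * Diagonal gates and controlled phases *)

Definition expi (x : R) : R[i] := (cos x +i* sin x)%C.

Lemma expi0 : expi 0 = 1. Proof. by rewrite /expi cos0 sin0. Qed.

Lemma expiD x y : expi (x + y) = expi x * expi y.
Proof.
by rewrite /expi cosD sinD; apply/eqP; rewrite eq_complex /= eqxx addrC eqxx.
Qed.

Lemma expiX x n : expi (x * n%:R) = expi x ^+ n.
Proof.
elim: n => [|n IHn]; first by rewrite mulr0 expi0.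
by rewrite -natr1 mulrDr mulr1 expiD IHn exprSr.
Qed.

Lemma expiJ x : (expi x)^*%C = expi (- x).
Proof. by rewrite /expi cosN sinN. Qed.

Lemma expi_mulJ x : expi x * (expi x)^*%C = 1.
Proof. by rewrite expiJ -expiD subrr expi0. Qed.

Definition phase (th : nat -> R) f y : R[i] := expi (th y) * f y.

Lemma implements_phase_bit t (th : bool -> R) :
  implements 1 (phase (fun y => th (bit t y))).
Proof.
apply: (@eq_implements _ (app1 t (fun i j => (i == j)%:R * expi (th i)))).
  move=> f y _; rewrite /app1 /phase; have := setbit_id t y.
  by case: (bit t y) => ->; rewrite /= !mul0r mul1r ?addr0 ?add0r.
apply: implements_app1 => -[] [] /=;
  by rewrite ?(mul0r, mul1r, conjc0, mulr0, add0r, addr0) ?expi_mulJ.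
Qed.

Lemma implements_phaseD L1 L2 th1 th2 :
  implements L1 (phase th1) -> implements L2 (phase th2) ->
  implements (L1 + L2) (phase (fun y => th1 y + th2 y)).
Proof.
move=> h1 h2; apply: eq_implements (implements_comp h1 h2) => f y _.
by rewrite /phase expiD mulrA.
Qed.

(** Conjugating a diagonal operator by a CNOT permutes its diagonal. This turns the sign of one
    qubit into the sign of a parity. *)
Lemma implements_phase_cnot L a b th : a != b -> implements L (phase th) ->
  implements L.+2 (phase (fun y => th (cnot_map a b y))).
Proof.
move=> nab h; have hc := implements_cnot nab.
rewrite -[L.+2]/(1 + L.+1)%N -[L.+1]addn1.
apply: eq_implements (implements_comp hc (implements_comp h hc)) => f y _.
by rewrite /phase cnot_mapK.
Qed.

Definition sgn (i : bool) : R := if i then -1 else 1.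

Lemma implements_Z t x : implements 1 (phase (fun y => x * sgn (bit t y))).
Proof. exact: (implements_phase_bit t (fun i => x * sgn i)). Qed.

Lemma implements_ZZ a b x : a != b ->
  implements 3 (phase (fun y => x * sgn (bit a y (+) bit b y))).
Proof.
move=> nab; rewrite eq_sym in nab.
apply: eq_implements (implements_phase_cnot nab (implements_Z a x)) => f y _.
by rewrite /phase bit_cnot eqxx.
Qed.

Lemma implements_ZZZ a b c x : a != b -> a != c -> b != c ->
  implements 5 (phase (fun y => x * sgn (bit a y (+) bit b y (+) bit c y))).
Proof.
move=> nab nac nbc; rewrite eq_sym in nbc.
apply: eq_implements (implements_phase_cnot nbc (implements_ZZ x nab)) => f y _.
rewrite /phase !bit_cnot eqxx /= val_eqE (negPf nab) /= addbF.
by rewrite addbA.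
Qed.

(* The indicator of [bit b && bit c] is (1 - Z_b)(1 - Z_c)/4, where Z is the
   sign of a qubit, and a function of [bit a] is affine in Z_a; expanding gives
   eight phases depending on parities only. *)
Lemma implements_cphase a b c (th : bool -> R) : a != b -> a != c -> b != c ->
  implements 18
    (phase (fun y => if bit b y && bit c y then th (bit a y) else 0)).
Proof.
move=> nab nac nbc.
(* The 8 combines the quarter from the indicator with the half from the affine form of [th]. The
   four pairs of phases below cost 2, 4, 4 and 8 gates, 18 in all. *)
pose S := (th false + th true) / 8; pose D := (th false - th true) / 8.
have h1 := implements_phaseD (implements_phase_bit a (fun=> S))
  (implements_Z b (- S)).
have h2 := implements_phaseD (implements_Z c (- S)) (implements_ZZ S nbc).
have h3 := implements_phaseD (implements_Z a D) (implements_ZZ (- D) nab).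
have h4 := implements_phaseD (implements_ZZ (- D) nac)
  (implements_ZZZ D nab nac nbc).
have h := implements_phaseD (implements_phaseD h1 h2) (implements_phaseD h3 h4).
apply: eq_implements h => f y _; congr (expi _ * _); rewrite /S /D.
by case: (bit a y); case: (bit b y); case: (bit c y) => /=; field.
Qed.

(** The cascade of controlled rotations at one level of the Fourier circuit: bit [c < k] of [y]
    contributes the angle [th * 2 ^ c], by one controlled phase. The bounds keep the three qubits
    distinct. *)
Lemma implements_phase_mod p b (th : bool -> R) k : (k <= b)%N -> (b < p)%N ->
  implements (18 * k)
    (phase (fun y => if bit b y then th (bit p y) * (y %% 2 ^ k)%N%:R else 0)).
Proof.
move=> + hbp; elim: k => [|k IHk] hk.
  apply: eq_implements implements_id => f y _.
  by rewrite /phase modn1 mulr0 if_same expi0 mul1r.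
pose c := Ordinal (ltn_trans hk (ltn_ord b)).
have npb : p != b by rewrite -val_eqE gtn_eqF.
have npc : p != c by rewrite -val_eqE gtn_eqF //= (ltn_trans hk).
have nbc : b != c by rewrite -val_eqE gtn_eqF.
have h := implements_cphase (fun i => th i * (2 ^ k)%:R) npb npc nbc.
rewrite mulnS; apply: eq_implements (implements_phaseD h (IHk (ltnW hk))).
move=> f y _; congr (expi _ * _) => /=.
have -> : (y %% 2 ^ k.+1 = bit k y * 2 ^ k + y %% 2 ^ k)%N.
  rewrite {1}(nat_bit k y) mulnDl -mulnA -expnS -addnA modn_cat //.
  have := ltn_pmod y (expn2_gt0 k); rewrite expnS.
  by case: (bit k y); lia.
case: (bit b y); last by rewrite addr0.
by case: (bit k y); rewrite /= ?mul1n ?add0r // natrD mulrDr.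
Qed.

Lemma implements_rotate p n : (n <= p)%N ->
  implements (3 * n) (fun f y => f (rotate n y)).
Proof.
elim: n => [|n IHn] hn; first exact: implements_id.
pose a := Ordinal (ltn_trans hn (ltn_ord p)).
pose b := Ordinal (leq_ltn_trans hn (ltn_ord p)).
have nab : a != b by rewrite -val_eqE /= ltn_eqF.
have hab := implements_cnot nab; rewrite eq_sym in nab.
have hba := implements_cnot nab.
(* Precompositions compose in reverse: the inner map [rotate n] is the outer operator. *)
have := implements_comp (IHn (ltnW hn))
  (implements_comp hab (implements_comp hba hab)).
by rewrite mulnS addnC.
Qed.

End Circuits.

(** * The Fourier transform on the low qubits *)

Section Fourier.
Variable R : realType.
Implicit Types (f : nat -> R[i]) (s i j : bool) (n h x y : nat).
Local Arguments conjc : simpl never.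
Local Arguments real_complex_def : simpl never.

Definition angle s n : R := sgn R s * (2 * pi / (2 ^ n)%:R).

Definition omega s n : R[i] := expi (angle s n).

Lemma angleS s n : angle s n.+1 * 2 = angle s n.
Proof.
have h : (2 ^ n)%:R != 0 :> R by rewrite pnatr_eq0 -lt0n expn2_gt0.
by rewrite /angle expnS natrM; field.
Qed.

Lemma omegaS s n : omega s n.+1 ^+ 2 = omega s n.
Proof. by rewrite -expiX angleS. Qed.

Lemma omega_half s n : omega s n.+1 ^+ (2 ^ n) = -1.
Proof.
rewrite -expiX; have -> : angle s n.+1 * (2 ^ n)%:R = sgn R s * pi.
  have h : (2 ^ n)%:R != 0 :> R by rewrite pnatr_eq0 -lt0n expn2_gt0.
  by rewrite /angle expnS natrM; field.
apply/eqP; rewrite eq_complex /expi; case: s => /=.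
  by rewrite mulN1r cosN sinN cospi sinpi oppr0 !eqxx.
by rewrite mul1r cospi sinpi oppr0 !eqxx.
Qed.

Lemma omega_order s n : omega s n ^+ (2 ^ n) = 1.
Proof.
case: n => [|n]; last by rewrite expnSr exprM omega_half sqrrN expr1n.
rewrite expr1 -omegaS -[omega s 1]/(omega s 1 ^+ (2 ^ 0)) omega_half.
by rewrite sqrrN expr1n.
Qed.

Lemma omegaVP n : omega false n * omega true n = 1.
Proof. by rewrite -expiD /angle /= mul1r mulN1r subrr expi0. Qed.

(** The order divides [2 ^ n], so it is a power of 2; a smaller one would contradict
    [omega_half]. *)
Lemma omega_prim s n : (2 ^ n).-primitive_root (omega s n).
Proof.
have [d dP /(dvdn_pfactor _ _ (isT : prime 2))[k hk dE]] :=
  prim_order_exists (expn2_gt0 n) (omega_order s n).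
suff e : n = k by rewrite {1}e -dE.
apply/eqP; rewrite eqn_leq hk andbT leqNgt; apply/negP => hkn.
case: n hk hkn dP => // n _ hkn dP.
have : omega s n.+1 ^+ (2 ^ n) = 1.
  rewrite -(subnKC (hkn : k <= n)%N) expnD exprM.
  by rewrite subnKC // -dE (prim_expr_order dP) expr1n.
by rewrite omega_half => /eqP; rewrite eqNr oner_eq0.
Qed.

Definition rt2 : R[i] := (Num.sqrt 2)^-1%:C%C.

Lemma rt2_sqr : rt2 ^+ 2 = 2^-1.
Proof.
rewrite /rt2 -rmorphXn /= exprVn sqr_sqrtr ?ler0n // fmorphV /=.
by rewrite rmorph_nat.
Qed.

Lemma rt2J : rt2^*%C = rt2. Proof. exact: conjc_real. Qed.

Definition had i j : R[i] := if i && j then - rt2 else rt2.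

Lemma had_unitary : unitary_fun had.
Proof.
have h : rt2 * rt2 + rt2 * rt2 = 1 by rewrite -expr2 rt2_sqr; field.
move=> [] []; rewrite /had /= ?rmorphN /= ?rt2J ?mulrN ?mulNr ?opprK //.
- by rewrite subrr.
- by rewrite subrr.
Qed.

(** The Fourier transform of the low [n] qubits, with the sign of the exponent selected by qubit
    [p]: a constant [sg] gives [F] or its conjugate, and [sg = id] gives [W]. *)
Definition dft (sg : bool -> bool) (p n : nat) f y : R[i] :=
  rt2 ^+ n * \sum_(x < 2 ^ n)
    omega (sg (bit p y)) n ^+ ((y %% 2 ^ n) * x) * f (y %/ 2 ^ n * 2 ^ n + x)%N.

Lemma sum_exp2S n (G : nat -> R[i]) :
  \sum_(x < 2 ^ n.+1) G x = \sum_(x < 2 ^ n) (G x + G (2 ^ n + x)%N).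
Proof. by rewrite expnS mul2n -addnn big_split_ord /= -big_split. Qed.

Lemma setbit_cat n h x i j : (x < 2 ^ n)%N ->
  setbit n j ((h * 2 + i) * 2 ^ n + x) = ((h * 2 + j) * 2 ^ n + x)%N.
Proof.
move=> hx; apply: bit_ext => t; rewrite bit_setbit !bit_cat // !bit_cons.
case: (ltngtP t n) => [|hnt|->] //; last by rewrite subnn.
by case: (t - n)%N (subn_gt0 n t); rewrite ?hnt.
Qed.

(* Writing the output index as 2 j + b and the input index as b' 2^n + x, the
   phase (2 j + b)(b' 2^n + x) / 2^(n+1) is, modulo 1, the sum of
   j x / 2^n, b x / 2^(n+1) and b b' / 2. *)
Lemma dftS sg p n f y : (n < p)%N ->
  dft sg p n.+1 f y =
  dft sg p n (phase (fun z => if bit n z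
      then angle (sg (bit p z)) n.+1 * (z %% 2 ^ n)%N%:R else 0)
    (app1 n had f)) (rotate n y).
Proof.
move=> hnp.
have [h [j [b [hj yE]]]] : exists h (j : nat) (b : bool),
    (j < 2 ^ n)%N /\ y = (h * 2 ^ n.+1 + (j * 2 + b))%N.
  exists (y %/ 2 ^ n.+1)%N, (y %% 2 ^ n.+1 %/ 2)%N, (bit 0 (y %% 2 ^ n.+1)%N).
  rewrite -nat_cons -divn_eq ltn_divLR // -expnSr ltn_pmod ?expn2_gt0 //.
have hl : (j * 2 + b < 2 ^ n.+1)%N by rewrite expnSr; case: (b); lia.
(* As [n < p], qubit [p] is a bit of [h], so both sides select the same sign. *)
have hcat (b' : bool) x : (x < 2 ^ n)%N ->
    bit p ((h * 2 + b') * 2 ^ n + x) = bit p y.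
  move=> hx; rewrite yE !bit_cat // bit_cons.
  have -> : (p < n)%N = false by lia.
  have -> : (p < n.+1)%N = false by lia.
  by rewrite subnS; case: (p - n)%N (subn_gt0 n p); rewrite ?hnp.
have rE : rotate n y = ((h * 2 + b) * 2 ^ n + j)%N by rewrite yE rotateE.
have dE : (y %/ 2 ^ n.+1 = h)%N by rewrite yE divn_cat.
have mE : (y %% 2 ^ n.+1 = j * 2 + b)%N by rewrite yE modn_cat.
rewrite /dft rE dE mE hcat // divn_cat // modn_cat //.
set w := omega _ n.+1; set w0 := omega _ n.
rewrite (sum_exp2S n
  (fun x => w ^+ ((j * 2 + b) * x) * f (h * 2 ^ n.+1 + x)%N)).
rewrite exprSr -mulrA; congr (_ * _).
rewrite mulr_sumr; apply: eq_bigr => x _; have hx := ltn_ord x.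
rewrite /phase /app1 !setbit_cat // hcat // bit_cat // ltnn subnn bit_cons.
rewrite modn_cat //.
have ww : w ^+ 2 = w0 by exact: omegaS.
have e1 : expi (if b then angle (sg (bit p y)) n.+1 * x%:R else 0) =
    w ^+ (b * x).
  by case: (b); rewrite ?expi0 ?mul1n ?expiX.
have e2 : w ^+ ((j * 2 + b) * x) = w0 ^+ (j * x) * w ^+ (b * x).
  by rewrite mulnDl exprD -ww -exprM mulnAC mulnC.
have e3 : w ^+ ((j * 2 + b) * 2 ^ n) = (-1) ^+ b.
  rewrite mulnDl -mulnA -expnS exprD [(j * _)%N]mulnC exprM omega_order expr1n.
  by rewrite mul1r mulnC exprM omega_half.
rewrite mulnDr exprD e1 e2 e3 mulnDl mul0n addn0 -mulnA -expnS.
rewrite mulnDl mul1n -mulnA -expnS !addnA.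
by rewrite /had; case: (b) => /=; ring.
Qed.

Lemma implements_dft m sg (p : 'I_m) n : (n <= p)%N ->
  implements m (21 * n ^ 2) (dft sg p n).
Proof.
elim: n => [|n IHn] hn.
  apply: eq_implements (implements_id R m) => f y _.
  by rewrite /dft big_ord1 /= muln0 !expr0 !mul1r divn1 muln1 addn0.
pose b := Ordinal (ltn_trans hn (ltn_ord p)).
have h1 := implements_app1 b had_unitary.
have h2 := implements_phase_mod (fun i => angle (sg i) n.+1) (leqnn b) hn.
have h3 := implements_rotate R (ltnW hn).
have h := implements_comp h3
  (implements_comp (IHn (ltnW hn)) (implements_comp h2 h1)).
apply: implements_leq (eq_implements _ h) => [|f y _]; last by rewrite dftS.
(* One level adds [3 * n] gates for the rotation, [18 * n] for the phases and one Hadamard gate. *)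
by rewrite /=; lia.
Qed.

(** * Fourier matrices, their inverses and cubes *)

Definition dft_mx s n : 'M[R[i]]_(2 ^ n) :=
  \matrix_(x, y) (rt2 ^+ n * omega s n ^+ (x * y)).

Lemma rt2_expn n : rt2 ^+ n * rt2 ^+ n * (2 ^ n)%:R = 1.
Proof.
rewrite -expr2 exprAC rt2_sqr natrX -exprMn mulVf ?expr1n //.
by rewrite pnatr_eq0.
Qed.

Lemma sum_root_unity N (z : R[i]) : z ^+ N = 1 ->
  \sum_(x < N) z ^+ x = if z == 1 then N%:R else 0.
Proof.
case: eqP => [-> _|/eqP z1 zN].
  by under eq_bigr do rewrite expr1n; rewrite sumr_const card_ord.
apply: (mulfI (x := z - 1)); first by rewrite subr_eq0.
by rewrite -subrX1 zN subrr mulr0.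
Qed.

Lemma omega_mul_order s s' n x y :
  (omega s n ^+ x * omega s' n ^+ y) ^+ (2 ^ n) = 1.
Proof.
by rewrite exprMn ![(_ ^+ _) ^+ (2 ^ n)]exprAC !omega_order !expr1n mulr1.
Qed.

(** Each entry is the average of the powers of a [2 ^ n]-th root of unity, a geometric sum that
    vanishes unless the root is 1. *)
Lemma dft_mxM s s' n : dft_mx s n *m dft_mx s' n =
  \matrix_(x, y) (omega s n ^+ x * omega s' n ^+ y == 1)%:R.
Proof.
apply/matrixP => x y; rewrite !mxE.
under eq_bigr => l _.
  rewrite !mxE mulrACA [(l * y)%N]mulnC !exprM -(exprMn l); over.
rewrite -mulr_sumr sum_root_unity ?omega_mul_order //.
by case: eqP; rewrite ?rt2_expn ?mulr0.
Qed.

Lemma dft_mxV n : dft_mx false n *m dft_mx true n = 1%:M.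
Proof.
rewrite dft_mxM; apply/matrixP => x y; rewrite !mxE.
have hu : omega false n ^+ y * omega true n ^+ y = 1.
  by rewrite -exprMn omegaVP expr1n.
have nz : omega true n ^+ y != 0.
  by apply/eqP => e0; move/eqP: hu; rewrite e0 mulr0 eq_sym oner_eq0.
(* Writing 1 as the product in [hu] and cancelling leaves an equality of two powers of a primitive
   root with exponents below its order. *)
rewrite -hu (inj_eq (mulIf nz)) (eq_prim_root_expr (omega_prim _ _)).
by rewrite !modn_small.
Qed.


Lemma imag_sqr : 'i%C * 'i%C = -1 :> R[i].
Proof.
apply/eqP; rewrite eq_complex /=.
by rewrite !(mulr0, mul0r, mulr1, subr0, add0r, addr0, oppr0) !eqxx.
Qed.

Lemma imagJ : ('i^*)%C = - 'i%C :> R[i].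
Proof. by apply/eqP; rewrite eq_complex /= oppr0 !eqxx. Qed.

Lemma expiE (x : R) : expi x = (cos x)%:C%C + 'i%C * (sin x)%:C%C.
Proof.
apply/eqP; rewrite eq_complex /=.
by rewrite !(mulr0, mul0r, mul1r, subr0, add0r, addr0) !eqxx.
Qed.

Lemma rt2X n : rt2 ^+ n = ((Num.sqrt (2 ^ n)%:R)^-1)%:C%C.
Proof.
rewrite /rt2 -rmorphXn /= exprVn; congr (_^-1%:C)%C.
elim: n => [|k IHk]; first by rewrite sqrtr1.
by rewrite expnS natrM sqrtrM ?ler0n // -IHk exprS.
Qed.

Lemma omegaX s n x : omega s n ^+ x = expi (angle s n * x%:R).
Proof. by rewrite expiX. Qed.

Lemma dft_mxE s n (x y : 'I_(2 ^ n)) :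
  dft_mx s n x y = rt2 ^+ n * omega s n ^+ (x * y).
Proof. by rewrite mxE. Qed.

(** Both squares are the permutation matrix of negation modulo [2 ^ n], since inverse roots have the
    same exponents giving 1. Hence [F^3 = F F' F' = F']. *)
Lemma dft_mx_cube n :
  dft_mx false n *m (dft_mx false n *m dft_mx false n) = dft_mx true n.
Proof.
suff -> : dft_mx false n *m dft_mx false n = dft_mx true n *m dft_mx true n.
  by rewrite mulmxA dft_mxV mul1mx.
rewrite !dft_mxM; apply/matrixP => x y; rewrite [LHS]mxE [RHS]mxE.
rewrite -(exprD (omega false n)) -(exprD (omega true n)).
have h : omega false n ^+ (x + y) * omega true n ^+ (x + y) = 1.
  by rewrite -exprMn omegaVP expr1n.
congr ((nat_of_bool _)%:R); apply/eqP/eqP => e; move: h; rewrite e.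
  by rewrite mul1r.
by rewrite mulr1.
Qed.

End Fourier.

(** * The Hartley transform *)

Section Interference.
Variables (K : fieldType) (N : nat) (A B : 'M[K]_N) (v : 'cV[K]_N) (i r : K).

(** The algebraic core, with [A = F], [B = F'] and [r = 1 / sqrt 2]: the two equations are the
    ancilla components 0 and 1 after the last gate. The summands with 0 match the form in which
    [app1_pair] delivers them. *)
Lemma interference (a := (1 + i) / 2) (b := (1 - i) / 2)
    (s0 := A *m (a *: v + a *: 0)) (s1 := B *m (b *: v + (- b) *: 0)) :
  A *m B = 1%:M -> A *m (A *m A) = B -> i * i = -1 -> r * r * 2 = 1 ->
  r *: (A *m (A *m (r *: s0 + r *: s1))) +
    (- (r * i)) *: (B *m (A *m (r *: s0 + (- r) *: s1))) =
    (b *: A + a *: B) *m v /\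
  r *: (A *m (A *m (r *: s0 + r *: s1))) +
    (r * i) *: (B *m (A *m (r *: s0 + (- r) *: s1))) = 0.
Proof.
move=> AB1 AAA hi hr; have BA1 := mulmx1C AB1.
have n2 : 2 != 0 :> K.
  by apply/eqP => e2; move/eqP: hr; rewrite e2 mulr0 eq_sym oner_eq0.
rewrite /s0 /s1 !scaler0 !addr0 [B *m (A *m _)]mulmxA BA1 mul1mx.
rewrite !mulmxDr -!scalemxAr !mulmxA.
rewrite -[A *m A *m A]mulmxA AAA -[A *m A *m B]mulmxA AB1 mulmx1.
(* From [i * i = -1] follow [- i * a = b] and [i * b = a], so the two branches agree in the first
   equation and cancel in the second. *)
rewrite mulmxDl -!scalemxAl; move: (A *m v) (B *m v) => u w; rewrite /a /b.
split; apply/colP => x; rewrite !mxE; last by field: hi.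
by rewrite -[RHS]mul1r -[X in _ = X * _]hr; field: hi.
Qed.

End Interference.

Section Hartley.
Variables (R : realType) (n : nat).
Implicit Types (u v : 'cV[R[i]]_(2 ^ n)).
Local Arguments conjc : simpl never.
Local Arguments real_complex_def : simpl never.

Local Opaque expi omega rt2 dft_mx.

Local Notation I := ('i%C : R[i]).
Local Notation r := (rt2 R).
Local Notation F := (dft_mx R false n).
Local Notation Fc := (dft_mx R true n).

(* cas t = ((1 - i) e^{it} + (1 + i) e^{-it}) / 2 *)
Lemma hartleyE :
  hartley R n = ((1 - I) / 2) *: F + ((1 + I) / 2) *: Fc.
Proof.
apply/matrixP => x y; rewrite [LHS]mxE.
rewrite [RHS]mxE [X in X + _]mxE [X in _ + X]mxE.
rewrite !dft_mxE rt2X !omegaX.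
rewrite rmorphM /= mulrCA [X in _ + X]mulrCA -mulrDr; congr (_ * _).
set t := 2 * pi * _ / _.
have tE b : angle R b n * (x * y)%:R = sgn R b * t.
  by rewrite /angle -mulrA [in LHS]mulrAC.
rewrite !tE mul1r mulN1r !expiE cosN sinN rmorphN /cas rmorphD /=.
by field: (imag_sqr R).
Qed.

(* The state |0> (x) u0 + |1> (x) u1, the first factor being the ancilla. *)
Definition pair_state u0 u1 (y : nat) : R[i] :=
  (if bit n y then u1 else u0) (Ordinal (ltn_pmod y (expn2_gt0 n))) 0.

Lemma pair_stateE u0 u1 (h : nat) (b : bool) (x : 'I_(2 ^ n)) :
  pair_state u0 u1 ((h * 2 + b) * 2 ^ n + x) = (if b then u1 else u0) x 0.
Proof.
rewrite /pair_state bit_cat // ltnn subnn bit_cons; congr (fun_of_matrix _ _ _).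
by apply: val_inj; rewrite /= modn_cat.
Qed.

Lemma app1_pair (g : bool -> bool -> R[i]) u0 u1 :
  app1 n g (pair_state u0 u1) =
  pair_state (g false false *: u0 + g false true *: u1)
             (g true false *: u0 + g true true *: u1).
Proof.
(* Equality holds at every natural number because [pair_state] ignores the bits above [n]. *)
apply/funext => y.
pose x := Ordinal (ltn_pmod y (expn2_gt0 n)).
rewrite /app1 (pair_stateE _ _ _ false x) (pair_stateE _ _ _ true x).
by rewrite /pair_state; case: (bit n y); rewrite !mxE.
Qed.

Lemma dft_pair sg u0 u1 :
  dft sg n n (pair_state u0 u1) =
  pair_state (dft_mx R (sg false) n *m u0) (dft_mx R (sg true) n *m u1).
Proof.
apply/funext => y.
rewrite /dft [in RHS]/pair_state mulr_sumr.
have -> : (y %/ 2 ^ n = y %/ 2 ^ n.+1 * 2 + bit n y)%N.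
  by rewrite {1}(nat_bit n y) divn_cat // ltn_pmod ?expn2_gt0.
under eq_bigr do rewrite pair_stateE mulrA.
by case: (bit n y); rewrite mxE; apply: eq_bigr => x _; rewrite dft_mxE.
Qed.

Lemma vec_pair0 v : vec n.+1 (pair_state v 0) = embed n.+1 v.
Proof.
apply/colP => y; rewrite !mxE /pair_state; case: insubP => [x hx xE|].
  rewrite bit_small //; congr (v _ _); apply: val_inj => /=.
  by rewrite xE modn_small.
rewrite -leqNgt => hy.
(* Here [2 ^ n <= y < 2 ^ n.+1], so the ancilla bit is set and selects the zero component. *)
have -> : bit n y = true; last by rewrite mxE.
have hy2 : (y < 2 ^ n * 2)%N by rewrite -expnSr.
rewrite /bit; have -> : (y %/ 2 ^ n = 1)%N; last by [].
apply/eqP; rewrite eqn_leq -ltnS ltn_divLR ?expn2_gt0 // mulnC hy2.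
by rewrite leq_divRL ?expn2_gt0 // mul1n.
Qed.

(** The first column is the ancilla state to prepare; the second completes it to a unitary
    matrix. *)
Let prep (i j : bool) : R[i] :=
  if i then (if j then - ((1 - I) / 2) else (1 - I) / 2) else (1 + I) / 2.

(** This gate takes [(|0> + i |1>) / sqrt 2] to [|0>]. *)
Let unprep (i j : bool) : R[i] :=
  if j then (if i then r * I else - (r * I)) else r.

Lemma prep_unitary : unitary_fun prep.
Proof.
have hI := imag_sqr R.
have h2 : (2^-1 : R[i])^*%C = 2^-1 by rewrite conjc_inv conjc_nat.
by move=> [] []; rewrite /prep /= ?rmorphN ?rmorphM ?rmorphB ?rmorphD /=
  ?rmorph1 h2 imagJ; field: hI.
Qed.

Lemma unprep_unitary : unitary_fun unprep.
Proof.
have hI := imag_sqr R.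
have hr : r * r * 2 = 1 by rewrite -expr2 rt2_sqr mulVf // pnatr_eq0.
move=> [] []; rewrite /unprep /= ?rmorphN ?rmorphM /= imagJ rt2J;
  by [rewrite -[RHS]hr; ring: hI | ring: hI].
Qed.

Lemma hartley_pair v :
  app1 n unprep (dft id n n (dft (fun=> false) n n (app1 n (had R)
    (dft id n n (app1 n prep (pair_state v 0)))))) =
  pair_state (hartley R n *m v) 0.
Proof.
have hr : r * r * 2 = 1 by rewrite -expr2 rt2_sqr mulVf // pnatr_eq0.
have [e0 e1] :=
  interference v (dft_mxV R n) (dft_mx_cube R n) (imag_sqr R) hr.
rewrite app1_pair dft_pair app1_pair !dft_pair app1_pair hartleyE.
by congr pair_state; [exact: e0 | exact: e1].
Qed.

Lemma implements_hartley : exists gs : seq 'M[R[i]]_(2 ^ n.+1),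
  [/\ forall G, G \in gs -> elementary_gate G, (size gs <= 63 * n ^ 2 + 3)%N
    & forall v, circuit_mx gs *m embed n.+1 v = embed n.+1 (hartley R n *m v)].
Proof.
pose p : 'I_n.+1 := ord_max.
have hW sg := @implements_dft R n.+1 sg p n (leqnn n).
have h1 := implements_app1 p prep_unitary.
have h2 := implements_app1 p (had_unitary R).
have h3 := implements_app1 p unprep_unitary.
(* The circuits [W], [F], [W] cost [21 * n ^ 2] gates each, and there are three gates on the
   ancilla. *)
have [gs [gsE gsL gsT]] := implements_comp h3 (implements_comp (hW id)
  (implements_comp (hW (fun=> false)) (implements_comp h2
  (implements_comp (hW id) h1)))).
exists gs; split=> // [|v]; first by apply: leq_trans gsL _; lia.
rewrite -!vec_pair0 gsT; congr vec; exact: hartley_pair.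
Qed.

End Hartley.

Theorem mainTheorem7 :
  exists (c k : nat), (0 < c)%N /\
  forall (R : realType) (n : nat), (1 <= n)%N ->
  exists gs : seq 'M[R[i]]_(2 ^ (n.+1 + k)),
    (forall G, G \in gs -> elementary_gate G) /\ (size gs <= c * n ^ 2)%N /\
    forall v : 'cV[R[i]]_(2 ^ n),
      circuit_mx gs *m embed (n.+1 + k) v = embed (n.+1 + k) (hartley R n *m v).
Proof.
(* No scratch qubits are used, and [63 * n ^ 2 + 3 <= 66 * n ^ 2] because [n >= 1]. *)
exists 66%N, 0%N; split=> // R n hn; rewrite addn0.
have [gs [gsE gsL gsT]] := implements_hartley R n.
exists gs; split=> //; split=> //; apply: leq_trans gsL _.
have : (1 <= n ^ 2)%N by rewrite expn_gt0 hn.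
by move: (n ^ 2)%N => N; lia.
Qed.
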